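(* Let $F$ be an infinitely generated free group. Then the subgroup $\operatorname{Inn}(F)$ of all conjugations (inner automorphisms of $F$) is a $\varnothing$-definable subgroup of $\operatorname{Aut}(F)$.
   Context: A subset of a group $G$ is $\varnothing$-definable in $G$ if it is the set of realizations in $G$ of a first-order formula of the language of groups without parameters. *)

(* Defs.v *)
From HB Require Import structures.
From mathcomp Require Import all_boot.
From mathcomp Require Import boolp classical_sets.

Set Implicit Arguments.
Unset Strict Implicit.
Unset Printing Implicit Defensive.

Local Open Scope classical_set_scope.
Local Open Scope group_scope.

Section Subgroups.
Variable G : groupType.

Definition subgroup (S : set G) : Prop :=
  S 1 /\ forall x y, S x -> S y -> S (x / y).

Definition generated (A : set G) : set G := smallest subgroup A.

Definition finitely_generated : Prop :=
  exists s : seq G, generated [set` s] = setT.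

(* Universal property of a free generating set. The map to be extended is
   given on all of G, but only its values on B matter. *)
Definition free_basis (B : set G) : Prop :=
  forall (H : groupType) (f : G -> H),
    exists! phi : G -> H,
      {morph phi : x y / x * y} /\ (forall b, B b -> phi b = f b).

Definition free_group : Prop := exists B : set G, free_basis B.

End Subgroups.

Section Automorphisms.
Variable G : groupType.

Definition is_aut (f : G -> G) : Prop :=
  {morph f : x y / x * y} /\ bijective f.

Record Aut : Type := MkAut { aut_fun :> G -> G; _ : `[< is_aut aut_fun >] }.

HB.instance Definition _ := [isSub for aut_fun].
HB.instance Definition _ := [Choice of Aut by <:].

Lemma autP (a : Aut) : is_aut a.
Proof. by case: a => f /= /asboolP. Qed.

Lemma aut_ext (a b : Aut) : a =1 b -> a = b.
Proof. by move=> ab; apply/val_inj/funext. Qed.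

Lemma id_is_aut : is_aut id.
Proof. by split=> //; exists id. Qed.

Lemma comp_is_aut (a b : Aut) : is_aut (a \o b).
Proof.
have [aM abij] := autP a; have [bM bbij] := autP b.
by split; [move=> x y /=; rewrite bM aM | exact: bij_comp].
Qed.

Lemma aut_inverse (a : Aut) : exists b : Aut, cancel a b /\ cancel b a.
Proof.
have [aM [g ag ga]] := autP a.
suff gaut : is_aut g by exists (MkAut (asboolT gaut)).
split; last by exists a.
by move=> x y; rewrite -{1}(ga x) -{1}(ga y) -aM ag.
Qed.

Definition aut_one : Aut := MkAut (asboolT id_is_aut).

Definition aut_mul (a b : Aut) : Aut := MkAut (asboolT (comp_is_aut a b)).

Definition aut_inv (a : Aut) : Aut := sval (cid (aut_inverse a)).

Lemma aut_mulA : associative aut_mul.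
Proof. by move=> a b c; apply: aut_ext. Qed.

Lemma aut_mul1 : left_id aut_one aut_mul.
Proof. by move=> a; apply: aut_ext. Qed.

Lemma aut_mulr1 : right_id aut_one aut_mul.
Proof. by move=> a; apply: aut_ext. Qed.

Lemma aut_mulV : left_inverse aut_one aut_inv aut_mul.
Proof.
by move=> a; apply: aut_ext => x; rewrite /= /aut_inv; case: cid => /= b [].
Qed.

Lemma aut_mulrV : right_inverse aut_one aut_inv aut_mul.
Proof.
by move=> a; apply: aut_ext => x; rewrite /= /aut_inv; case: cid => /= b [].
Qed.

HB.instance Definition _ := hasMul.Build Aut aut_mul.
HB.instance Definition _ := Magma_isSemigroup.Build Aut aut_mulA.
HB.instance Definition _ := hasOne.Build Aut aut_one.
HB.instance Definition _ := BaseUMagma_isUMagma.Build Aut aut_mul1 aut_mulr1.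
HB.instance Definition _ := hasInv.Build Aut aut_inv.
HB.instance Definition _ := Monoid_isGroup.Build Aut aut_mulV aut_mulrV.

Definition Inn : set Aut := [set a : Aut | exists g : G, forall x, a x = x ^ g].

End Automorphisms.

(* First-order language of groups. A term or formula of index n has its free
   variables among v_0, ..., v_(n-1); a quantifier binds v_0 of its body and
   the variable v_(i+1) of the body is v_i outside. *)
Inductive gterm (n : nat) : Type :=
| TVar of 'I_n
| TOne
| TMul of gterm n & gterm n
| TInv of gterm n.

Arguments TOne {n}.

Inductive gformula : nat -> Type :=
| FEq n of gterm n & gterm n : gformula n
| FFalse n : gformula n
| FNot n of gformula n : gformula n
| FAnd n of gformula n & gformula n : gformula n
| FOr n of gformula n & gformula n : gformula n
| FImp n of gformula n & gformula n : gformula n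
| FForall n of gformula n.+1 : gformula n
| FExists n of gformula n.+1 : gformula n.

Section Semantics.
Variable G : groupType.

Fixpoint teval n (e : 'I_n -> G) (t : gterm n) : G :=
  match t with
  | TVar i => e i
  | TOne => 1
  | TMul t1 t2 => teval e t1 * teval e t2
  | TInv t1 => (teval e t1)^-1
  end.

Definition env_cons n (x : G) (e : 'I_n -> G) : 'I_n.+1 -> G :=
  fun i => oapp e x (unlift ord0 i).

Fixpoint gholds n (f : gformula n) : ('I_n -> G) -> Prop :=
  match f in gformula m return ('I_m -> G) -> Prop with
  | FEq _ t1 t2 => fun e => teval e t1 = teval e t2
  | FFalse _ => fun=> False
  | FNot _ f1 => fun e => ~ gholds f1 e
  | FAnd _ f1 f2 => fun e => gholds f1 e /\ gholds f2 e
  | FOr _ f1 f2 => fun e => gholds f1 e \/ gholds f2 e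
  | FImp _ f1 f2 => fun e => gholds f1 e -> gholds f2 e
  | FForall _ f1 => fun e => forall x, gholds f1 (env_cons x e)
  | FExists _ f1 => fun e => exists x, gholds f1 (env_cons x e)
  end.

Definition realizations (f : gformula 1) : set G :=
  [set x | gholds f (fun=> x)].

Definition definable (S : set G) : Prop :=
  exists f : gformula 1, S = realizations f.

Definition definable_subgroup (S : set G) : Prop := subgroup S /\ definable S.

End Semantics.

(* Main.v *)
(* An automorphism [phi] is inner iff for all [a], [b], [c] such that
   [z = [~ a, phi]] is nontrivial and [b], [c] commute with [z] and [z ^ phi],
   [phi] commutes with [[~ b, c]].

   If [phi] is conjugation by [g], then [z] is conjugation by some [u <> 1], and
   [b], [c] fix [u] and multiply [g] by elements of the centralizer of [u].
   That centralizer is abelian and [b], [c] fix it pointwise, because each of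
   its elements has a positive power in [<u>] and roots in it are unique; so [[~ b, c]]
   fixes [g].

   Conversely, let [a] be conjugation by some [k] with [phi k <> k]. Then any
   [b], [c] fixing the finitely many generators that occur in two elements of
   [F] qualify, and their commutators include all transvections [x := x * d]
   with [x] outside that finite set. Applying [phi] to these commutation
   relations, [w = phi x] satisfies [w(y * x) = w(y) * w(x)] for a fresh
   generator [y], which forces [w = u * x * u^-1] with [u] free of [x]; the
   transvections [x := x * d] then give [phi d = u * d * u^-1] for every
   generator [d]. *)

From HB Require Import structures.
Require Import Defs.
From mathcomp Require Import all_boot.
From mathcomp Require Import boolp classical_sets.

Set Implicit Arguments.
Unset Strict Implicit.
Unset Printing Implicit Defensive.

Local Open Scope classical_set_scope.
Local Open Scope group_scope.

(** * Reduced words *)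

Section CommutingSequences.
Variable A : Type.
Implicit Types p s t : seq A.

(** A sequence commuting with [p] is a prefix of a power of [p], so its length determines it. The
    induction strips a leading [p] until at most [size p] letters remain. *)
Lemma cat_comm_size_inj p t t' : p <> [::] ->
  t ++ p = p ++ t -> t' ++ p = p ++ t' -> size t = size t' -> t = t'.
Proof.
move=> p0; have sp : 0 < size p by case: p p0.
move: {2}(size t) (leqnn (size t)) => n.
elim: n t t' => [|n IHn] t t' tn tp tp' st.
  have t0 : size t = 0 by apply/eqP; rewrite -leqn0.
  by rewrite (size0nil t0); rewrite t0 in st; rewrite (size0nil (esym st)).
have [le_tp|lt_pt] := leqP (size t) (size p).
  have Et s : s ++ p = p ++ s -> size s <= size p -> s = take (size s) p.
    move=> sp' le_sp; have := congr1 (take (size s)) sp'.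
    by rewrite take_size_cat // takel_cat.
  by rewrite (Et t) // (Et t') // -st.
have cut s : size p < size s -> s ++ p = p ++ s ->
    s = p ++ drop (size p) s /\
    drop (size p) s ++ p = p ++ drop (size p) s.
  move=> ps sp'; have def_s : s = p ++ drop (size p) s.
    have := congr1 (take (size p)) sp'.
    rewrite takel_cat ?(ltnW ps) // take_size_cat // => {1}<-.
    by rewrite cat_take_drop.
  split=> //; have : p ++ drop (size p) s ++ p = p ++ p ++ drop (size p) s.
    by rewrite catA -def_s sp'.
  by move/(congr1 (drop (size p))); rewrite !drop_size_cat.
have [def_t ct] := cut t lt_pt tp.
have [|def_t' ct'] := cut t' _ tp'; first by rewrite -st.
rewrite def_t def_t'; congr (_ ++ _); apply: IHn => //.
  by rewrite size_drop leq_subLR (leq_trans tn) // -add1n leq_add2r.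
by rewrite !size_drop st.
Qed.

Lemma cat_comm_cat p s t :
  s ++ p = p ++ s -> t ++ p = p ++ t -> (s ++ t) ++ p = p ++ s ++ t.
Proof. by move=> sp tp; rewrite -catA tp !catA sp. Qed.

Definition ncat n s := iter n (cat s) [::].

Lemma size_ncat n s : size (ncat n s) = (n * size s)%N.
Proof. by elim: n => //= n IHn; rewrite size_cat IHn mulSn. Qed.

Lemma cat_comm_ncat p s n :
  s ++ p = p ++ s -> ncat n s ++ p = p ++ ncat n s.
Proof.
move=> sp; elim: n => [|n IHn]; first by rewrite /= cats0.
exact: cat_comm_cat.
Qed.

End CommutingSequences.

Section ReducedWords.
Variable T : eqType.
Implicit Types (x y : T * bool) (p q s t : seq (T * bool)).

(** The letter [(a, false)] stands for the generator [a], and [(a, true)] for its inverse. *)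
Definition linv x := (x.1, ~~ x.2).
Definition winv p := rev (map linv p).
Definition reduced p := sorted (fun x y => y != linv x) p.

Lemma linvK : involutive linv.
Proof. by case=> a e; rewrite /linv /= negbK. Qed.

Lemma linv_neq x : linv x != x.
Proof. by case: x => a []; rewrite /linv xpair_eqE eqxx. Qed.

Lemma winvK : involutive winv.
Proof. by move=> p; rewrite /winv map_rev revK mapK //; exact: linvK. Qed.

Lemma winv_cat p q : winv (p ++ q) = winv q ++ winv p.
Proof. by rewrite /winv map_cat rev_cat. Qed.

Lemma winv_rcons p x : winv (rcons p x) = linv x :: winv p.
Proof. by rewrite /winv map_rcons rev_rcons. Qed.

Lemma winv_cons x p : winv (x :: p) = rcons (winv p) (linv x).
Proof. by rewrite /winv /= rev_cons. Qed.

Lemma size_winv p : size (winv p) = size p.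
Proof. by rewrite size_rev size_map. Qed.

Lemma mem_winv p (a : T) :
  (a \in map fst (winv p)) = (a \in map fst p).
Proof. by rewrite /winv map_rev mem_rev -map_comp. Qed.

Lemma reduced_winv p : reduced p -> reduced (winv p).
Proof.
move=> rp; rewrite /reduced /winv rev_sorted; apply: homo_sorted rp => x y yx.
by rewrite linvK eq_sym (can2_eq linvK linvK) eq_sym in yx *.
Qed.

Lemma reduced_catl p q : reduced (p ++ q) -> reduced p.
Proof. by case/cat_sorted2. Qed.

Lemma reduced_catr p q : reduced (p ++ q) -> reduced q.
Proof. by case/cat_sorted2. Qed.

Lemma reduced_cat3 p q s : q <> [::] ->
  reduced (p ++ q) -> reduced (q ++ s) -> reduced (p ++ q ++ s).
Proof.
case: q => // x q _; rewrite /reduced /= !sorted_cat_cons !cat_path.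
by move=> /andP[-> ->] /andP[_ ->].
Qed.

Lemma reduced_rcons_cat p x y q :
  reduced (rcons p x ++ y :: q) =
  [&& reduced (rcons p x), reduced (y :: q) & y != linv x].
Proof.
by rewrite /reduced cat_rcons sorted_cat_cons /= [X in _ && X]andbC.
Qed.

Lemma reduced_rcons_catP p x q : reduced (rcons p x) -> reduced q ->
  reduced (rcons p x ++ q) \/ exists q', q = linv x :: q'.
Proof.
case: q => [|y q] rp rq; first by left; rewrite cats0.
rewrite reduced_rcons_cat rp rq /=.
by have [->|] := eqVneq y (linv x); [right; exists q | left].
Qed.

(** Cancel at the junction as long as possible; [s2] is the part of [s] that disappears. *)
Lemma reduced_cancel s t : reduced s -> reduced t ->
  exists s1 s2 t1, [/\ s = s1 ++ s2, t = winv s2 ++ t1 & reduced (s1 ++ t1)].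
Proof.
elim/last_ind: s t => [|s x IHs] t rs rt; first by exists [::], [::], t.
have [rst|[t' def_t]] := reduced_rcons_catP rs rt.
  by exists (rcons s x), [::], t; rewrite cats0.
have rs' : reduced s by rewrite -cats1 in rs; apply: reduced_catl rs.
have rt' : reduced t' by apply: (@reduced_catr [:: linv x]); rewrite cat1s -def_t.
have [s1 [s2 [t1 [-> def_t' r1]]]] := IHs t' rs' rt'.
exists s1, (rcons s2 x), t1; split=> //; first by rewrite rcons_cat.
by rewrite def_t def_t' winv_rcons.
Qed.

Lemma reduced_ncat p n : reduced (p ++ p) -> reduced (ncat n p).
Proof.
move=> rpp; case: p rpp => [|x p] rpp; first by elim: n.
elim: n => [|[|n] IHn] //; first by rewrite /ncat /iter cats0 (reduced_catl rpp).
exact: reduced_cat3.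
Qed.

(** If both fail, the last letter of [t] is inverse to the first letters of [p] and of [winv p].
    Then [p] begins with the inverse of its last letter, so [p ++ p] is not reduced. *)
Lemma reduced_cat_or p t : p <> [::] -> reduced (p ++ p) -> reduced t ->
  reduced (t ++ p) \/ reduced (t ++ winv p).
Proof.
case/lastP: p => // p x _ rpp rt.
have rp := reduced_catl rpp; have rpi := reduced_winv rp.
case/lastP: t rt => [|t y] rt; first by left.
have [|[p1 def_p1]] := reduced_rcons_catP rt rp; first by left.
have [|[p2 def_p2]] := reduced_rcons_catP rt rpi; first by right.
have /(inv_inj linvK) xy : linv x = linv y.
  by move: def_p2; rewrite winv_rcons => /(congr1 (head x)).
by move: rpp; rewrite {2}def_p1 reduced_rcons_cat xy eqxx !andbF.
Qed.

(** Strip the two outer letters while they are inverse to each other. What remains is cyclically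
    reduced, which is what [reduced (q ++ q)] expresses. *)
Lemma cyclic_reduction p : reduced p -> p <> [::] ->
  exists k q, [/\ q <> [::], reduced (q ++ q) & p = k ++ q ++ winv k].
Proof.
move: {2}(size p) (leqnn (size p)) => n; elim: n p => [|n IHn] p.
  by rewrite leqn0 size_eq0 => /eqP ->.
case/lastP: p => // p x; rewrite size_rcons ltnS => sp rp _.
have [rpp|[p' def_p]] := reduced_rcons_catP rp rp.
  by exists [::], (rcons p x); rewrite cats0; split=> //; case: (p).
case: p def_p sp rp => [|y p] def_p sp rp.
  by have /esym/eqP := congr1 (head x) def_p; rewrite /= (negPf (linv_neq x)).
have {}def_p : y = linv x by have := congr1 (head x) def_p.
rewrite def_p /= in rp *.
have rp' : reduced p.
  by move: rp => /= /path_sorted; rewrite -cats1 => /reduced_catl.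
have p0 : p <> [::] by move=> p0; move: rp; rewrite p0 /= linvK eqxx.
have [k [q [q0 rqq ->]]] := IHn p (ltnW sp) rp' p0.
exists (linv x :: k), q; split=> //.
by rewrite winv_cons linvK -!cats1 -!catA.
Qed.

Section Substitution.
Variables b c : T.
Hypothesis neq_cb : c != b.

Definition lren x := if x.1 == b then (c, x.2) else x.
Definition wren p := map lren p.

(** This is the substitution of [c * b] for [b] on one letter; an inverse letter yields the inverse
    of [c * b]. *)
Definition ldup x :=
  if x.1 == b then
    if x.2 then [:: (b, true); (c, true)] else [:: (c, false); (b, false)]
  else [:: x].
Definition wdup p := flatten (map ldup p).

Lemma reduced_wren p : c \notin map fst p -> reduced p -> reduced (wren p).
Proof.
move=> cp rp; apply: (homo_sorted_in (P := fun x => x.1 != c)) rp; last first.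
  by apply/allP => x xp; apply: contra cp => /eqP <-; apply: map_f.
move=> [x e] [y f]; rewrite !unfold_in /lren /linv /= !xpair_eqE.
move=> xc yc; have [->|_] := eqVneq x b; have [_|_] := eqVneq y b => //=;
  rewrite !xpair_eqE ?eqxx //= => _.
- by rewrite (negPf yc).
- by rewrite eq_sym (negPf xc).
Qed.

(** As [c] is new, two blocks can only meet in a cancelling pair if they come from mutually inverse
    letters. The path is started at the last letter [lst x] of the preceding block. *)
Lemma reduced_wdup p : c \notin map fst p -> reduced p -> reduced (wdup p).
Proof.
pose lst x := last x (ldup x).
have lastE y x : last y (ldup x) = lst x.
  by rewrite /lst /ldup; case: ifP => // _; case: ifP.
have bc : b == c = false by rewrite eq_sym (negPf neq_cb).
have cb := negPf neq_cb.
have step x p' : c \notin map fst (x :: p') -> reduced (x :: p') ->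
    path (fun x y => y != linv x) (lst x) (wdup p').
  elim: p' x => //= y p' IHp x; rewrite !inE !negb_or => /and3P[cx cy cp].
  case/andP=> yx rp; rewrite /wdup /= cat_path lastE IHp ?inE ?negb_or ?cy //.
  rewrite andbT; case: x y yx cx cy {rp} => [x e] [y f].
  rewrite /lst /ldup /linv /= !xpair_eqE => yx cx cy.
  move: yx cx cy; have [->|xb] := eqVneq x b; have [->|yb] := eqVneq y b;
    case: e; case: f => //=; rewrite /linv /= !xpair_eqE ?eqxx ?bc ?cb //=;
    by rewrite ?andbT ?andbF //= => yx cx cy //; rewrite eq_sym.
case: p => // x p cp rp; have := step x p cp rp.
rewrite /wdup /= /lst /ldup; case: ifP => //= _; case: ifP => //= _ ->;
  by rewrite /linv !xpair_eqE /= ?andbF ?bc ?cb.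
Qed.

End Substitution.

End ReducedWords.

(** * Free groups *)

Section Symmetries.
Variable X : choiceType.

(** Permutation groups are the test groups to which the universal property is applied: reduced words
    are shown to be normal forms by letting [F] act on suitable sets. *)
Record Sym : Type := MkSym { sym_fun :> X -> X; _ : `[< bijective sym_fun >] }.

HB.instance Definition _ := [isSub for sym_fun].
HB.instance Definition _ := [Choice of Sym by <:].

Lemma symP (a : Sym) : bijective a.
Proof. by case: a => f /= /asboolP. Qed.

Lemma sym_ext (a b : Sym) : a =1 b -> a = b.
Proof. by move=> ab; apply/val_inj/funext. Qed.

Lemma id_bij : bijective (@id X).
Proof. by exists id. Qed.

Definition sym_one : Sym := MkSym (asboolT id_bij).

Definition sym_mul (a b : Sym) : Sym :=
  MkSym (asboolT (bij_comp (symP a) (symP b))).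

Lemma sym_inverse (a : Sym) : exists b : Sym, cancel a b /\ cancel b a.
Proof.
have [g ag ga] := symP a.
by have gbij : bijective g by [exists a]; exists (MkSym (asboolT gbij)).
Qed.

Definition sym_inv (a : Sym) : Sym := sval (cid (sym_inverse a)).

Lemma sym_mulA : associative sym_mul.
Proof. by move=> a b c; apply: sym_ext. Qed.

Lemma sym_mul1 : left_id sym_one sym_mul.
Proof. by move=> a; apply: sym_ext. Qed.

Lemma sym_mulr1 : right_id sym_one sym_mul.
Proof. by move=> a; apply: sym_ext. Qed.

Lemma sym_mulV : left_inverse sym_one sym_inv sym_mul.
Proof.
by move=> a; apply: sym_ext => x; rewrite /= /sym_inv; case: cid => /= b [].
Qed.

Lemma sym_mulrV : right_inverse sym_one sym_inv sym_mul.
Proof.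
by move=> a; apply: sym_ext => x; rewrite /= /sym_inv; case: cid => /= b [].
Qed.

HB.instance Definition _ := hasMul.Build Sym sym_mul.
HB.instance Definition _ := Magma_isSemigroup.Build Sym sym_mulA.
HB.instance Definition _ := hasOne.Build Sym sym_one.
HB.instance Definition _ := BaseUMagma_isUMagma.Build Sym sym_mul1 sym_mulr1.
HB.instance Definition _ := hasInv.Build Sym sym_inv.
HB.instance Definition _ := Monoid_isGroup.Build Sym sym_mulV sym_mulrV.
End Symmetries.

Section Morphisms.
Variables (G H : groupType) (f : G -> H).
Hypothesis fM : {morph f : x y / x * y}.

Lemma morph_one : f 1 = 1.
Proof. by apply: (@mulgI _ (f 1)); rewrite -fM !mulg1. Qed.

Lemma morph_inv : {morph f : x / x^-1}.
Proof. by move=> x; apply/esym/mulg1_eq; rewrite -fM mulgV morph_one. Qed.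

Lemma morph_exp n : {morph f : x / x ^+ n}.
Proof.
by move=> x; elim: n => [|n IHn]; rewrite ?expg0 ?morph_one // !expgS fM IHn.
Qed.

End Morphisms.

Section FreeGroups.
Variables (T : choiceType) (F : groupType) (iota : T -> F).

(** The universal property is split in two: existence makes distinct reduced words have distinct
    values, uniqueness makes every element the value of one. *)
Definition has_extensions : Prop := forall (H : groupType) (f : T -> H),
  exists phi : F -> H, {morph phi : x y / x * y} /\ phi \o iota =1 f.

Definition unique_extensions : Prop := forall (H : groupType) (phi psi : F -> H),
  {morph phi : x y / x * y} -> {morph psi : x y / x * y} ->
  phi \o iota =1 psi \o iota -> phi =1 psi.

Implicit Types (x y : T * bool) (p q s t : seq (T * bool)).

Definition leval x : F := if x.2 then (iota x.1)^-1 else iota x.1.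

Definition weval p : F := foldr (fun x g => leval x * g) 1 p.

Lemma leval_linv x : leval (linv x) = (leval x)^-1.
Proof. by case: x => a []; rewrite /leval /= ?invgK. Qed.

Lemma weval_cons x p : weval (x :: p) = leval x * weval p.
Proof. by []. Qed.

Lemma weval_cat p q : weval (p ++ q) = weval p * weval q.
Proof. by elim: p => /= [|x p ->]; rewrite ?mul1g ?mulgA. Qed.

Lemma weval_winv p : weval (winv p) = (weval p)^-1.
Proof.
elim: p => [|x p IHp] /=; first by rewrite invg1.
by rewrite winv_cons -cats1 weval_cat IHp /= mulg1 leval_linv invgM.
Qed.

Lemma weval_ncat n p : weval (ncat n p) = weval p ^+ n.
Proof. by elim: n => //= n IHn; rewrite expgS weval_cat -IHn. Qed.

Lemma weval_mul s t : reduced s -> reduced t ->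
  exists s1 s2 t1, [/\ s = s1 ++ s2, t = winv s2 ++ t1, reduced (s1 ++ t1)
    & weval (s1 ++ t1) = weval s * weval t].
Proof.
move=> rs rt; have [s1 [s2 [t1 [-> -> r1]]]] := reduced_cancel rs rt.
by exists s1, s2, t1; split; rewrite // !weval_cat weval_winv -mulgA mulVKg.
Qed.

(* The values of reduced words form a subgroup [K] containing the generators.
   Swapping the two sheets of [F * bool] over [K] commutes with left
   translation by the generators, hence by all of [F], so [K] is [F]. *)
Lemma weval_surj : unique_extensions ->
  forall g, exists2 p, reduced p & weval p = g.
Proof.
move=> uniqF; pose K g := `[< exists2 p, reduced p & weval p = g >].
have KM g h : K g -> K h -> K (g * h).
  move=> /asboolP[p rp <-] /asboolP[q rq <-]; apply/asboolP.
  by have [p1 [_ [q1 [_ _ r1 <-]]]] := weval_mul rp rq; exists (p1 ++ q1).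
have KV g : K g -> K g^-1.
  move=> /asboolP[p rp <-]; apply/asboolP.
  by exists (winv p); [apply: reduced_winv | rewrite weval_winv].
have K1 : K 1 by apply/asboolP; exists [::].
have Ki a : K (iota a).
  by apply/asboolP; exists [:: (a, false)]; rewrite //= mulg1.
have KMl g h : K g -> K (g * h) = K h.
  move=> Kg; apply/idP/idP => [/(KM _ _ (KV _ Kg))|]; last exact: KM.
  by rewrite mulKg.
pose flip (u : F * bool) := (u.1, K u.1 (+) u.2).
have flipK : involutive flip by case=> g e; rewrite /flip /= addbA addbb.
have flip_bij : bijective flip by exists flip.
pose sigma : Sym (F * bool)%type := MkSym (asboolT flip_bij).
have tr_bij (g : F) : bijective (fun u : F * bool => (g * u.1, u.2)).
  exists (fun u => (g^-1 * u.1, u.2)) => -[h e] /=; by rewrite ?mulKg ?mulVKg.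
pose tr g : Sym (F * bool)%type := MkSym (asboolT (tr_bij g)).
have trM : {morph tr : g h / g * h}.
  by move=> g h; apply: sym_ext => -[k e] /=; rewrite mulgA.
have conjM : {morph (fun g => tr g ^ sigma) : g h / g * h}.
  by move=> g h; rewrite trM conjMg.
have tr_conj : (fun g => tr g ^ sigma) =1 tr.
  apply: uniqF => // a /=; apply/conjg_fixP/commgP; apply: sym_ext => -[h e].
  by rewrite /= /flip /= KMl.
move=> g; apply/asboolP; rewrite -/(K g).
have /conjg_fixP/commgP/(congr1 (fun a : Sym _ => a (1, false))) := tr_conj g.
by rewrite /= /flip /= mulg1 K1 => -[]; case: (K g).
Qed.

(** Van der Waerden's argument: letters permute the reduced words by left multiplication followed by
    cancellation ([push]), and the value of a reduced word [p] sends the empty word to [p]. *)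
Lemma weval_inj : has_extensions ->
  {in (fun p => reduced p) &, injective weval}.
Proof.
move=> extF; pose W := {p : seq (T * bool) | reduced p}.
pose push x p := if p is y :: p' then if y == linv x then p' else x :: p
                 else [:: x].
have push_red x p : reduced p -> reduced (push x p).
  case: p => //= y p rp; have [_|yx] := eqVneq; first exact: path_sorted rp.
  by rewrite /reduced /= yx.
have pushK x p : reduced p -> push (linv x) (push x p) = p.
  case: p => [|y p] rp /=; first by rewrite linvK eqxx.
  have [Ey|yx] := eqVneq y (linv x); last by rewrite /= linvK eqxx.
  case: p rp => [|z p] /= rp; first by rewrite Ey.
  by move: rp; rewrite Ey => /andP[/negPf -> _].
pose act x (u : W) : W := Sub (push x (val u)) (push_red x _ (valP u)).
have actK x : cancel (act x) (act (linv x)).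
  by move=> u; apply: val_inj; rewrite /= pushK // (valP u).
have act_bij x : bijective (act x).
  by exists (act (linv x)) => //; have := actK (linv x); rewrite linvK.
have [phi [phiM phi_iota]] :=
  extF (Sym W) (fun a => MkSym (asboolT (act_bij (a, false)))).
have phi_leval x : phi (leval x) =1 act x.
  case: x => a [] u; rewrite /leval /=; last by have /= -> := phi_iota a.
  rewrite morph_inv //; have /= -> := phi_iota a.
  rewrite -[u in LHS](actK (a, true)).
  set v := act (a, true) u; set s := MkSym _.
  by rewrite -[_ (act _ _)]/((s^-1 * s) v) mulVg.
have phi_weval p : reduced p -> val (phi (weval p) (Sub [::] isT)) = p.
  elim: p => [_|x p IHp rp] /=; first by rewrite morph_one.
  rewrite phiM /= phi_leval /= IHp; last exact: path_sorted rp.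
  by case: p rp {IHp} => //= y p /andP[/negPf ->].
by move=> p q rp rq pq; rewrite -(phi_weval p) // -(phi_weval q) // pq.
Qed.

End FreeGroups.

(** * Centralizers in free groups *)

Lemma commute_conj (G : groupType) (z x y : G) :
  commute x y -> commute (x ^ z) (y ^ z).
Proof. by rewrite /commute -!conjMg => ->. Qed.

Section Centralizers.
Variables (T : choiceType) (F : groupType) (iota : T -> F).
Hypothesis extF : has_extensions iota.
Hypothesis uniqF : unique_extensions iota.
Local Notation ev := (weval iota).
Implicit Types (p q t : seq (T * bool)) (u v x : F).

(** The reduced form of the product of [q] and [t] is [t ++ q], of full length, so nothing cancels
    in [q ++ t] either. *)
Lemma reduced_commute q t : reduced q -> reduced t -> reduced (t ++ q) ->
  commute (ev t) (ev q) -> t ++ q = q ++ t.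
Proof.
move=> rq rt rtq tq.
have [q1 [q2 [t1 [def_q def_t r1 ev1]]]] := weval_mul iota rq rt.
have E1 : q1 ++ t1 = t ++ q.
  by apply: (weval_inj extF); rewrite ?unfold_in // ev1 weval_cat.
have q20 : q2 = [::].
  apply: size0nil; move/(congr1 size)/eqP: E1.
  rewrite def_t def_q !size_cat size_winv addnACA (addnC (size q2)) addnACA.
  by rewrite -[X in X == _]addn0 eqn_add2l eq_sym addnn double_eq0 => /eqP.
by rewrite -E1 def_q def_t q20 cats0.
Qed.

(** The word of [v] can be followed by [p] or by [winv p] without cancellation, which turns
    commutation in [F] into commutation of sequences, for [v] or for its inverse. *)
Lemma centralizer_weval p v : p <> [::] -> reduced (p ++ p) ->
  commute v (ev p) ->
  exists2 t, t ++ p = p ++ t & v = ev t \/ v = (ev t)^-1.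
Proof.
move=> p0 rpp; have [t rt <-] := weval_surj uniqF v => tp.
have rp := reduced_catl rpp.
have [rtp|rtp] := reduced_cat_or p0 rpp rt.
  by exists t; [apply: reduced_commute | left].
exists (winv t); last by right; rewrite weval_winv invgK.
have /(congr1 (@winv _)) : t ++ winv p = winv p ++ t.
  apply: reduced_commute => //; first exact: reduced_winv.
  by rewrite weval_winv; apply: commuteV.
by rewrite !winv_cat winvK.
Qed.

Lemma conj_cyclically_reduced u : u <> 1 ->
  exists k p, [/\ p <> [::], reduced (p ++ p) & u = ev p ^ k].
Proof.
move=> u1; have [p rp def_u] := weval_surj uniqF u.
have [|k [q [q0 rqq def_p]]] := cyclic_reduction rp.
  by move=> p0; apply: u1; rewrite -def_u p0.
exists (ev k)^-1, q; split=> //.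
by rewrite -def_u def_p !weval_cat weval_winv conjgE invgK.
Qed.

(** Powers of a cyclically reduced word are reduced, hence nonempty. *)
Lemma free_torsion_free x n : 0 < n -> x ^+ n = 1 -> x = 1.
Proof.
move=> n0 xn; apply: contrapT => /conj_cyclically_reduced[k [p [p0 rpp def_x]]].
move: xn; rewrite def_x -conjXg => /eqP; rewrite conjg_eq1 => /eqP.
rewrite -weval_ncat => e1.
have : ncat n p = [::].
  by apply: (weval_inj extF); rewrite ?unfold_in // reduced_ncat.
move/(congr1 size)/eqP; rewrite size_ncat muln_eq0 size_eq0 => /orP[|/eqP //].
by rewrite eqn0Ngt n0.
Qed.

(** After conjugating [u] to a cyclically reduced [p], the words [t ++ t'] and [t' ++ t] both
    commute with [p] and have the same length, so they are equal. *)
Lemma free_commute_trans u v v' : u <> 1 ->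
  commute v u -> commute v' u -> commute v v'.
Proof.
move=> /conj_cyclically_reduced[k [p [p0 rpp ->]]].
have toev w : commute w (ev p ^ k) -> commute (w ^ k^-1) (ev p).
  by move/(commute_conj k^-1); rewrite conjgK.
move=> /toev vp /toev v'p; apply: (@conjg_inj _ k^-1).
rewrite [LHS]conjMg [RHS]conjMg.
have [t tp Et] := centralizer_weval p0 rpp vp.
have [t' tp' Et'] := centralizer_weval p0 rpp v'p.
have tt' : commute (ev t) (ev t').
  rewrite /commute -!weval_cat; congr weval.
  apply: (cat_comm_size_inj p0); rewrite ?size_cat 1?addnC // -?catA.
    by rewrite tp' !catA tp.
  by rewrite tp !catA tp'.
by case: Et => ->; case: Et' => ->; do ?[exact: tt' | apply: commuteV];
  do 1?[apply: commute_sym; apply: commuteV; apply: commute_sym];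
  do ?[exact: tt' | apply: commuteV].
Qed.

Lemma free_common_power u v : u <> 1 -> commute v u ->
  exists m n, 0 < m /\ (v ^+ m = u ^+ n \/ v ^+ m = (u ^+ n)^-1).
Proof.
move=> /conj_cyclically_reduced[k [p [p0 rpp ->]]] vp.
have vp' : commute (v ^ k^-1) (ev p).
  by have := commute_conj k^-1 vp; rewrite conjgK.
have [t tp Et] := centralizer_weval p0 rpp vp'.
(* These exponents give the powers of [t] and of [p] the same length; both commute with [p], so they
   coincide. *)
exists (size p), (size t); split; first by case: p p0 {rpp vp vp' tp}.
have Ept : ev t ^+ size p = ev p ^+ size t.
  rewrite -!weval_ncat; congr weval; apply: (cat_comm_size_inj p0).
  - exact: cat_comm_ncat.
  - exact: cat_comm_ncat.
  - by rewrite !size_ncat mulnC.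
have -> : v = (v ^ k^-1) ^ k by rewrite conjgKV.
by case: Et => ->; [left | right]; rewrite -!conjXg ?expVgn Ept // conjVg.
Qed.

(** Some positive power of [v] lies in the subgroup generated by [u] and is fixed by [b]. As [b v]
    and [v] both commute with [u], they commute with each other, and their quotient is torsion. *)
Lemma free_fix_centralizer (b : F -> F) u v : {morph b : x y / x * y} ->
  u <> 1 -> commute v u -> b u = u -> b v = v.
Proof.
move=> bM u1 vu bu.
have bvu : commute (b v) u by rewrite /commute -{1 2}bu -!bM vu.
have [m [n [m0 vm]]] := free_common_power u1 vu.
have bvm : b v ^+ m = v ^+ m.
  by rewrite -morph_exp //; case: vm => ->; rewrite ?morph_inv // morph_exp // bu.
have vbv := free_commute_trans u1 bvu vu.
apply: divg1_eq; apply: (free_torsion_free m0).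
by rewrite expgnFl // bvm mulgV.
Qed.

Lemma iota_commute_inj a b : commute (iota a) (iota b) -> a = b.
Proof.
move=> ab; have [//|neq_ab] := eqVneq a b.
pose ab2 (x y : T) := [:: (x, false); (y, false)].
suff: ab2 a b = ab2 b a by case.
apply: (weval_inj extF); rewrite ?unfold_in /= ?mulg1 //.
- by rewrite /linv /= xpair_eqE andbF.
- by rewrite /linv /= xpair_eqE andbF.
Qed.

Lemma free_center_trivial (a b : T) z : a <> b -> (forall x, commute z x) -> z = 1.
Proof.
move=> ab zC; apply: contrapT => z1; apply/ab/iota_commute_inj.
by apply: (free_commute_trans z1); apply: commute_sym.
Qed.

End Centralizers.

(** * Inner automorphisms *)

Section InnerAutomorphisms.
Variable G : groupType.
Implicit Types (a b : Aut G) (g h x : G).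

Lemma autM a : {morph a : x y / x * y}.
Proof. by case: (autP a). Qed.

Lemma aut_mulE a b x : (a * b) x = a (b x).
Proof. by []. Qed.

Lemma autK a : cancel a a^-1.
Proof. by move=> x; rewrite -aut_mulE mulVg. Qed.

Lemma autKV a : cancel a^-1 a.
Proof. by move=> x; rewrite -aut_mulE mulgV. Qed.

Lemma inn_is_aut g : is_aut (fun x => x ^ g^-1).
Proof.
split; first by move=> x y; rewrite conjMg.
by exists (fun x => x ^ g) => x; rewrite (conjgK, conjgKV).
Qed.

(** The inverse makes [inn] a homomorphism: [x ^ g] is a right action, whereas automorphisms compose
    as functions. *)
Definition inn g : Aut G := MkAut (asboolT (inn_is_aut g)).

Lemma innE g x : inn g x = x ^ g^-1.
Proof. by []. Qed.

Lemma InnP a : Inn a <-> exists g, a = inn g.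
Proof.
split=> -[g ag]; first by exists g^-1; apply: aut_ext => x; rewrite ag innE invgK.
by exists g^-1 => x; rewrite ag.
Qed.

Lemma innM : {morph inn : g h / g * h}.
Proof. by move=> g h; apply: aut_ext => x; rewrite aut_mulE !innE invgM conjgM. Qed.

Lemma inn_conj a g : inn g ^ a = inn (a^-1 g).
Proof.
apply: aut_ext => x; rewrite conjgE !aut_mulE !innE !conjgE invgK.
by rewrite !(autM a^-1) autK (morph_inv (autM a^-1)) invgK.
Qed.

Lemma inn_commg g a : [~ inn g, a] = inn (g^-1 * a^-1 g).
Proof. by rewrite commgEl inn_conj innM (morph_inv innM). Qed.

Lemma subgroup_Inn : subgroup (@Inn G).
Proof.
split=> [|a b /InnP[g ->] /InnP[h ->]]; apply/InnP.
  by exists 1; rewrite (morph_one innM).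
by exists (g / h); rewrite innM (morph_inv innM).
Qed.

Lemma commute_inn b g : b g = g -> commute b (inn g).
Proof.
move=> bg; apply/commute_sym/commgP/conjg_fixP.
by rewrite inn_conj -{1}bg autK.
Qed.

End InnerAutomorphisms.

Definition inner_like (G : groupType) (phi : G) : Prop :=
  forall a b c, [~ a, phi] <> 1 ->
    commute b [~ a, phi] -> commute b ([~ a, phi] ^ phi) ->
    commute c [~ a, phi] -> commute c ([~ a, phi] ^ phi) ->
    commute phi [~ b, c].

Section FreeGroupAutomorphisms.
Variables (T : choiceType) (F : groupType) (iota : T -> F).
Hypothesis extF : has_extensions iota.
Hypothesis uniqF : unique_extensions iota.
Hypothesis infT : forall s : seq T, exists a, a \notin s.
Local Notation ev := (weval iota).
Implicit Types (a b c d : T) (p q r s : seq (T * bool)) (g h u v w x z : F).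

Lemma inn_center z : inn z = 1 -> z = 1.
Proof.
move=> z1; have [a _] := infT [::]; have [b] := infT [:: a]; rewrite inE => ba.
apply: (@free_center_trivial _ _ _ extF uniqF b a) => [|x]; first exact/eqP.
rewrite -[z]invgK; apply/commute_sym/commuteV/commgP/conjg_fixP.
by rewrite -innE z1.
Qed.

(** Since the center of [F] is trivial, commutation in [Aut F] with a conjugation can be read as
    fixing an element of [F]. *)
Lemma commute_innP (b : Aut F) g : commute b (inn g) <-> b g = g.
Proof.
split=> [/commute_sym/commgP/eqP|]; last exact: commute_inn.
rewrite inn_commg => /inn_center/eqP; rewrite mulg_eq1 eqg_inv => /eqP gb.
by rewrite {1}gb autKV.
Qed.

Lemma inner_like_inn g : inner_like (inn g).
Proof.
move=> a b c; have [u ->] : exists u, [~ a, inn g] = inn u.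
  exists (g^-1 * a^-1 g)^-1.
  by rewrite -invgR inn_commg (morph_inv (@innM F)).
rewrite inn_conj.
have -> : (inn g)^-1 u = u ^ g by rewrite -(morph_inv (@innM F)) innE invgK.
move=> u1; have {}u1 : u <> 1 by move=> u0; rewrite u0 (morph_one (@innM F)) in u1.
move=> /commute_innP bu /commute_innP bug /commute_innP cu /commute_innP cug.
(* Applying [f] to [u ^ g] shows that [g] and [f g] conjugate [u] to the same element. *)
have multiplier (f : Aut F) : f u = u -> f (u ^ g) = u ^ g -> commute (f g / g) u.
  move=> fu; rewrite !conjgE !(autM f) (morph_inv (autM f)) fu => fug.
  have fgu : u * f g = f g * (g^-1 * (u * g)) by rewrite -fug mulVKg.
  by rewrite /commute [RHS]mulgA fgu !mulgA mulgK.
have vu := multiplier b bu bug; have v'u := multiplier c cu cug.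
have vv' := free_commute_trans extF uniqF u1 vu v'u.
have bv' := free_fix_centralizer extF uniqF (autM b) u1 v'u bu.
have cv := free_fix_centralizer extF uniqF (autM c) u1 vu cu.
(* Both [b] and [c] multiply [g] on the left by an element that the other one fixes. These two
   elements commute, so [b (c g) = c (b g)]. *)
have Eb : b (c g) = c g / g * (b g / g) * g.
  by rewrite -{1}(mulgVK g (c g)) (autM b) bv' -[RHS]mulgA mulgVK.
have Ec : c (b g) = b g / g * (c g / g) * g.
  by rewrite -{1}(mulgVK g (b g)) (autM c) cv -[RHS]mulgA mulgVK.
apply/commute_sym/commute_innP; rewrite commgEl conjgE !aut_mulE.
by rewrite Eb -vv' -Ec autK autK.
Qed.

End FreeGroupAutomorphisms.

(** * Substitutions *)

Section Substitutions.
Variables (T : choiceType) (F : groupType) (iota : T -> F).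
Hypothesis extF : has_extensions iota.
Hypothesis uniqF : unique_extensions iota.
Local Notation ev := (weval iota).
Implicit Types (a b c d : T) (p q r s : seq (T * bool)) (g h u v w x z : F).

Definition subst a g : F -> F :=
  sval (cid (extF (fun d => if d == a then g else iota d))).

Lemma substM a g : {morph subst a g : x y / x * y}.
Proof. by rewrite /subst; case: cid => f []. Qed.

Lemma subst_iota a g d : subst a g (iota d) = if d == a then g else iota d.
Proof. by rewrite /subst; case: cid => f [fM fi]; apply: fi. Qed.

Lemma subst_id a g : subst a g (iota a) = g.
Proof. by rewrite subst_iota eqxx. Qed.

Lemma subst_neq a g d : d != a -> subst a g (iota d) = iota d.
Proof. by rewrite subst_iota => /negPf ->. Qed.

Lemma eq_morph_weval (H : groupType) (phi psi : F -> H) p :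
  {morph phi : x y / x * y} -> {morph psi : x y / x * y} ->
  {in map fst p, forall d, phi (iota d) = psi (iota d)} ->
  phi (ev p) = psi (ev p).
Proof.
move=> phiM psiM; elim: p => [|[d e] p IHp] eqp; first by rewrite !morph_one.
rewrite weval_cons phiM psiM IHp => [|d' d'p]; last first.
  by apply: eqp; rewrite inE d'p orbT.
have Ed : phi (iota d) = psi (iota d) by apply: eqp; rewrite inE eqxx.
by rewrite /leval; case: e {eqp} => /=; rewrite ?morph_inv // Ed.
Qed.

Lemma subst_fix a g p : a \notin map fst p -> subst a g (ev p) = ev p.
Proof.
move=> ap; apply: (@eq_morph_weval _ (subst a g) id) => // [|d dp].
  exact: substM.
by apply: subst_neq; apply: contraNneq ap => <-.
Qed.

Lemma weval_wren a b p : ev (wren a b p) = subst a (iota b) (ev p).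
Proof.
have sM := @substM a (iota b).
elim: p => [|[d e] p IHp] /=; first by rewrite (morph_one sM).
rewrite sM -IHp; congr (_ * _); rewrite /leval /lren /=.
by case: e; rewrite ?(morph_inv sM) subst_iota; case: (d == a).
Qed.

Lemma weval_wdup a b p :
  ev (wdup a b p) = subst a (iota b * iota a) (ev p).
Proof.
have sM := @substM a (iota b * iota a).
elim: p => [|[d e] p IHp] /=; first by rewrite (morph_one sM).
rewrite sM -IHp weval_cat; congr (_ * _); rewrite /leval /ldup /=.
case: e; rewrite ?(morph_inv sM) subst_iota; case: (d == a) => /=;
  by rewrite /leval /= ?mulg1 ?invgM.
Qed.

(** The letter [x] cannot cancel against [p], in which its generator does not occur, so it shields
    the prefix [q]. *)
Lemma weval_mul_prefix q (x : T * bool) s p :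
  reduced (q ++ x :: s) -> reduced p -> x.1 \notin map fst p ->
  exists2 m, reduced (q ++ x :: m) & ev (q ++ x :: m) = ev (q ++ x :: s) * ev p.
Proof.
move=> rs rp xp.
have [s1 [s2 [t1 [def_s def_p r1 <-]]]] := weval_mul iota rs rp.
have xs2 : x \notin s2.
  apply: contra xp => xs2; rewrite def_p map_cat mem_cat mem_winv.
  by rewrite map_f.
have q1 : size q < size s1.
  rewrite ltnNge; apply: contra xs2 => le_s1.
  have -> : s2 = drop (size s1) (q ++ x :: s) by rewrite def_s drop_size_cat.
  by rewrite drop_cat ltn_neqAle le_s1 andbT; case: eqP => [->|_] /=;
    rewrite ?subnn ?mem_cat inE eqxx ?orbT.
have def_s1 : s1 = q ++ x :: take (size s1 - size q).-1 s.
  have {1}-> : s1 = take (size s1) (q ++ x :: s) by rewrite def_s take_size_cat.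
  rewrite take_cat ltnNge (ltnW q1) /=; congr (_ ++ _).
  by rewrite -{1}(prednK (n := size s1 - size q)) // subn_gt0.
exists (take (size s1 - size q).-1 s ++ t1).
  by rewrite -cat_cons catA -def_s1.
by rewrite -cat_cons catA -def_s1.
Qed.

Lemma first_occurrence a p : a \in map fst p ->
  exists q e r, p = q ++ (a, e) :: r /\ a \notin map fst q.
Proof.
elim: p => //= -[d e] p IHp; rewrite inE.
have [<- _|ad /= /IHp[q [f [r [-> aq]]]]] := eqVneq a d.
  by exists [::], e, p.
by exists ((d, e) :: q), f, r; rewrite inE negb_or ad.
Qed.

Lemma wren_cat a b p q : wren a b (p ++ q) = wren a b p ++ wren a b q.
Proof. exact: map_cat. Qed.

Lemma wdup_cat a b p q : wdup a b (p ++ q) = wdup a b p ++ wdup a b q.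
Proof. by rewrite /wdup map_cat flatten_cat. Qed.

Lemma wren_id a b p : a \notin map fst p -> wren a b p = p.
Proof.
elim: p => //= x p IHp; rewrite inE negb_or eq_sym => /andP[/negPf xa ap].
by rewrite IHp // /lren xa.
Qed.

Lemma wdup_id a b p : a \notin map fst p -> wdup a b p = p.
Proof.
elim: p => //= x p IHp; rewrite inE negb_or eq_sym => /andP[/negPf xa ap].
by rewrite /wdup /= -/(wdup a b p) IHp // /ldup xa.
Qed.

(* The reduced form of [w] with [a := b * a] keeps every [b] next to its [a],
   whereas the product on the right puts all its [b]'s before its [a]'s; so [w]
   has a single letter [a], with exponent 1. *)
Lemma subst_mul_conj a b p : reduced p -> a != b -> b \notin map fst p ->
  ev p <> 1 ->
  subst a (iota b * iota a) (ev p) = subst a (iota b) (ev p) * ev p ->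
  exists2 q, a \notin map fst q & ev p = ev q * iota a * (ev q)^-1.
Proof.
move=> rp ab bp w1 eq_w; have ba : b != a by rewrite eq_sym.
have ap : a \in map fst p.
  apply: contrapT => /negP ap; apply: w1; move: eq_w; rewrite !subst_fix //.
  by move=> E; apply: (@mulgI _ (ev p)); rewrite -E mulg1.
have := reduced_wdup ba bp rp; have := reduced_wren a bp rp.
move: eq_w; rewrite -weval_wdup -weval_wren.
have [q [e [r [def_p aq]]]] := first_occurrence ap.
have Edup : wdup a b p = q ++ ldup a b (a, e) ++ wdup a b r.
  by rewrite def_p wdup_cat wdup_id.
have Eren : wren a b p = q ++ (b, e) :: wren a b r.
  by rewrite def_p wren_cat wren_id //= /lren /= eqxx.
rewrite Eren Edup /ldup /= eqxx => eq_w rren rdup.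
(* If the first [a] is inverted, then after [q] the left word continues with the inverse of [a] and
   the right one with the inverse of [b]. *)
case: e def_p {Edup Eren} eq_w rren rdup => def_p eq_w rren rdup.
  have [m rm Em] := weval_mul_prefix rren rp bp.
  rewrite -Em in eq_w; have := weval_inj extF rdup rm eq_w.
  move/(congr1 (drop (size q))); rewrite !drop_size_cat // => /(congr1 (head (a, true))).
  by move=> /(congr1 fst) /= /eqP; rewrite (negPf ab).
have [ar|ar] := boolP (a \in map fst r); last first.
  exists q => //; move: eq_w.
  rewrite wren_id // wdup_id // def_p !weval_cat !weval_cons /leval /=.
  rewrite -!mulgA mul1g => /mulgI/mulgI eq_r.
  have rq : ev r * ev q = 1.
    by apply: (@mulIg _ (iota a * ev r)); rewrite mul1g -mulgA -eq_r.
  by rewrite -(mulg1_eq rq) invgK.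
(* With a second [a], the left word reads [q], [b], [a], while the right one reads [q], [b], [q2],
   [b], where [q2] is free of [a]. *)
have [q2 [e2 [r2 [def_r aq2]]]] := first_occurrence ar.
have Eren : wren a b r = q2 ++ (b, e2) :: wren a b r2.
  by rewrite def_r wren_cat wren_id //= /lren /= eqxx.
have Ecat : q ++ (b, false) :: wren a b r =
    (q ++ (b, false) :: q2) ++ (b, e2) :: wren a b r2.
  by rewrite Eren -catA.
rewrite Ecat in rren eq_w; have [m rm Em] := weval_mul_prefix rren rp bp.
rewrite -Em in eq_w; have := weval_inj extF rdup rm eq_w.
rewrite -catA => /(congr1 (drop (size q))); rewrite !drop_size_cat //.
case: q2 aq2 {def_r Eren Ecat rren rm eq_w Em} => [|[d f] q2] /=.
  by move=> _ [] /eqP; rewrite (negPf ab).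
by rewrite inE => aq2 [] ad; rewrite ad eqxx in aq2.
Qed.

End Substitutions.

(** * Infinite rank *)

Section InfiniteRank.
Variables (T : choiceType) (F : groupType) (iota : T -> F).
Hypothesis extF : has_extensions iota.
Hypothesis uniqF : unique_extensions iota.
Hypothesis infT : forall s : seq T, exists a, a \notin s.
Local Notation ev := (weval iota).
Local Notation subst := (subst extF).
Implicit Types (a b c d : T) (p q : seq (T * bool)) (g h u w x : F).

Lemma morph_comp (f g : F -> F) : {morph f : x y / x * y} ->
  {morph g : x y / x * y} -> {morph f \o g : x y / x * y}.
Proof. by move=> fM gM x y /=; rewrite gM fM. Qed.

Lemma cancel_gens (f g : F -> F) : {morph f : x y / x * y} ->
  {morph g : x y / x * y} -> (forall d, g (f (iota d)) = iota d) ->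
  cancel f g.
Proof.
move=> fM gM gfi; apply: (uniqF (phi := g \o f) (psi := id)) => //.
exact: morph_comp.
Qed.

Lemma aut_of_gens (f g : F -> F) : {morph f : x y / x * y} ->
  {morph g : x y / x * y} -> (forall d, g (f (iota d)) = iota d) ->
  (forall d, f (g (iota d)) = iota d) ->
  exists P : Aut F, P =1 f /\ P^-1 =1 g.
Proof.
move=> fM gM gfi fgi; have fK := cancel_gens fM gM gfi.
have gK := cancel_gens gM fM fgi.
have faut : is_aut f by split; last exists g.
exists (MkAut (asboolT faut)); split=> // x.
by rewrite -{1}(gK x) -[f _]/(MkAut (asboolT faut) (g x)) autK.
Qed.

Lemma right_transvection a c : c != a -> exists P : Aut F,
  P =1 subst a (iota a * (iota c)^-1) /\ P^-1 =1 subst a (iota a * iota c).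
Proof.
move=> ca; apply: aut_of_gens => [||d|d]; try exact: substM;
  rewrite subst_iota; have [->|da] := eqVneq d a;
  rewrite ?(subst_neq _ _ da) // substM ?(morph_inv (@substM _ _ _ _ _ _));
  by rewrite subst_id (subst_neq _ _ ca) (mulgK, mulgVK).
Qed.

Lemma left_transvection c d : d != c -> exists Q : Aut F,
  Q =1 subst c (iota d * iota c) /\ Q^-1 =1 subst c ((iota d)^-1 * iota c).
Proof.
move=> dc; apply: aut_of_gens => [||b|b]; try exact: substM;
  rewrite subst_iota; have [->|bc] := eqVneq b c;
  rewrite ?(subst_neq _ _ bc) // substM ?(morph_inv (@substM _ _ _ _ _ _));
  by rewrite subst_id (subst_neq _ _ dc) (mulKg, mulVKg).
Qed.

Lemma inner_like_transvection (phi : Aut F) k p q :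
  inner_like phi -> k^-1 * phi^-1 k <> 1 ->
  ev p = k^-1 * phi^-1 k -> ev q = phi^-1 (ev p) ->
  forall a d, a \notin map fst p -> a \notin map fst q -> d != a ->
  forall x, phi (subst a (iota a * iota d) x) =
            subst a (iota a * iota d) (phi x).
Proof.
move=> phi_inn h1 Ep Eq a d ap aq da.
(* The fresh [c] serves to write [a := a * d] as the commutator of [P], which is [a := a * c^-1],
   and [Q], which is [c := d * c]. Both fix the values of [p] and [q]. *)
have [c] := infT (a :: d :: map fst p ++ map fst q).
rewrite !inE mem_cat !negb_or => /and4P[ca cd cp cq].
have [P [PE PVE]] := right_transvection ca.
have dc : d != c by rewrite eq_sym.
have ac : a != c by rewrite eq_sym.
have [Q [QE QVE]] := left_transvection dc.
have Ecomm : [~ inn k, phi] = inn (ev p) by rewrite inn_commg Ep.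
have PQ : commute phi [~ P, Q].
  apply: (phi_inn (inn k)); rewrite Ecomm ?inn_conj -?Eq.
  - by move=> /(inn_center extF uniqF infT); rewrite Ep.
  - by apply: commute_inn; rewrite PE subst_fix.
  - by apply: commute_inn; rewrite PE subst_fix.
  - by apply: commute_inn; rewrite QE subst_fix.
  - by apply: commute_inn; rewrite QE subst_fix.
have PQE : [~ P, Q] =1 subst a (iota a * iota d).
  apply: uniqF => [||b]; [exact: autM | exact: substM |].
  rewrite /comp commgEl conjgE !aut_mulE PVE QVE PE QE.
  have sV e g := morph_inv (@substM _ _ _ extF e g).
  have s_ad g : subst a g (iota d) = iota d by rewrite subst_neq.
  have s_ac g : subst a g (iota c) = iota c by rewrite subst_neq.
  have s_ca g : subst c g (iota a) = iota a by rewrite subst_neq.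
  have s_cd g : subst c g (iota d) = iota d by rewrite subst_neq.
  have sE := (@substM _ _ _ extF, sV, subst_id, s_ad, s_ac, s_ca, s_cd).
  have [->|bc] := eqVneq b c; first by rewrite !sE mulVKg.
  have [->|ba] := eqVneq b a; last by rewrite !(subst_neq _ _ bc, subst_neq _ _ ba).
  by rewrite !sE invgM !mulgA mulgK invgK.
by move=> x; rewrite -!PQE -!aut_mulE PQ.
Qed.

Lemma inner_like_Inn (phi : Aut F) : inner_like phi -> Inn phi.
Proof.
move=> phi_inn; apply/InnP.
have [phi1|] := pselect (forall k, phi k = k).
  by exists 1; apply: aut_ext => x; rewrite phi1 innE invg1 conjg1.
(* With this [k], [phi^-1 k] is [k0], which differs from [k], so the commutator of [inn k] and [phi]
   is nontrivial. *)
move=> /existsNP[k0 phi_k0]; pose k := phi k0.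
have h1 : k^-1 * phi^-1 k <> 1.
  by rewrite /k autK => /mulg1_eq; rewrite invgK.
have [p _ Ep] := weval_surj uniqF (k^-1 * phi^-1 k).
have [q _ Eq] := weval_surj uniqF (phi^-1 (ev p)).
have phi_tr := inner_like_transvection phi_inn h1 Ep Eq.
have [a] := infT (map fst p ++ map fst q); rewrite mem_cat negb_or => /andP[ap aq].
have {}phi_tr_a d := phi_tr a d ap aq.
have [r rr Er] := weval_surj uniqF (phi (iota a)).
have [b] := infT (a :: map fst p ++ map fst q ++ map fst r).
rewrite inE !mem_cat !negb_or => /and4P[ba bp bq br].
have ab : a != b by rewrite eq_sym.
have phi_tr_b := phi_tr b a bp bq ab.
have sM e g := @substM _ _ _ extF e g.
(* Write [w] for [phi (iota a)] as a word in [a]. The next three equations eliminate [phi (iota b)]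
   and give [w(a * b * a) = w(a * b) * w(a)]. *)
have Eb : ev r * phi (iota b) = subst a (iota a * iota b) (ev r).
  by rewrite Er -phi_tr_a // subst_id (autM phi).
have Ea : phi (iota b) * ev r = subst b (iota b * iota a) (phi (iota b)).
  by rewrite -phi_tr_b subst_id (autM phi) Er.
have Eba : subst b (iota b * iota a) (subst a (iota a * iota b) (ev r)) =
    subst a (iota a * iota b) (ev r) * ev r.
  by rewrite -Eb sM -Ea subst_fix // mulgA.
(* Substituting [a^-1 * b] for [b] turns this into [w(b * a) = w(b) * w(a)]. *)
have eq_r : subst a (iota b * iota a) (ev r) = subst a (iota b) (ev r) * ev r.
  pose f := subst b ((iota a)^-1 * iota b).
  have fM : {morph f : x y / x * y} by apply: sM.
  have fr : f (ev r) = ev r by rewrite /f subst_fix.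
  have fa : f (iota a) = iota a by rewrite /f subst_neq.
  have fb : f (iota b) = (iota a)^-1 * iota b by rewrite /f subst_id.
  move/(congr1 f): Eba; rewrite fM fr => Eba.
  transitivity (f (subst b (iota b * iota a) (subst a (iota a * iota b) (ev r)))).
    apply: (@eq_morph_weval _ _ _ F (subst a (iota b * iota a))
      (f \o subst b (iota b * iota a) \o subst a (iota a * iota b))).
    - exact: sM.
    - by apply: morph_comp => //; apply: morph_comp.
    move=> d dr; have db : d != b by apply: contraNneq br => <-.
    have [->|da] := eqVneq d a; last first.
      by rewrite /= !subst_neq // /f subst_neq.
    by rewrite /= !subst_id sM subst_id subst_neq // fM fM fa fb mulgA mulVKg.
  rewrite Eba; congr (_ * _).
  apply: (@eq_morph_weval _ _ _ F (f \o subst a (iota a * iota b))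
    (subst a (iota b))).
  - exact: morph_comp.
  - exact: sM.
  move=> d dr; have db : d != b by apply: contraNneq br => <-.
  have [->|da] := eqVneq d a; last by rewrite /= !subst_neq // /f subst_neq.
  by rewrite /= !subst_id fM fa fb mulVKg.
have r1 : ev r <> 1.
  rewrite Er => /(congr1 phi^-1); rewrite autK (morph_one (autM _)) => a1.
  suff Eab : a = b by rewrite Eab eqxx in ab.
  (* A trivial generator would commute with every other one, while distinct generators do not
     commute. *)
  by apply: (iota_commute_inj extF); rewrite a1; apply/commute_sym/commute1.
have [s as' Es] := subst_mul_conj rr ab br r1 eq_r.
exists (ev s); apply: aut_ext; apply: uniqF => [||d]; [exact: autM | exact: autM |].
rewrite /comp innE conjgE invgK mulgA; have [->|da] := eqVneq d a.
  by rewrite -Er Es.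
(* As [phi] sends [a] to [s * a * s^-1], commuting with [a := a * d] gives
   [s * a * s^-1 * phi d = s * a * d * s^-1]. *)
have := phi_tr_a d da (iota a).
rewrite subst_id (autM phi) -Er Es !sM (morph_inv (sM _ _)) subst_id.
rewrite subst_fix // -!mulgA => /mulgI/mulgI E.
by apply: (@mulgI _ (ev s)^-1); rewrite E mulKg.
Qed.

End InfiniteRank.

(** * From free bases to indexed generators *)

Lemma free_basis_extensions (F : groupType) (B : set F) : free_basis B ->
  has_extensions (fun b : {x | x \in B} => val b).
Proof.
move=> freeB H f.
(* The value 1 outside [B] is an arbitrary default. *)
have [phi [[phiM phiB] _]] := freeB H (fun x => oapp f 1 (insub x)).
exists phi; split=> // b; rewrite /= phiB ?valK //.
exact: set_mem (valP b).
Qed.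

Lemma free_basis_unique (F : groupType) (B : set F) : free_basis B ->
  unique_extensions (fun b : {x | x \in B} => val b).
Proof.
move=> freeB H phi psi phiM psiM eqB.
have [chi [_ chi_uniq]] := freeB H phi.
suff -> : phi = psi by [].
rewrite -(chi_uniq phi) // -(chi_uniq psi) //; split=> // b Bb.
by have /= := eqB (Sub b (mem_set Bb)).
Qed.

Lemma infinite_basis (F : groupType) (B : set F) : free_basis B ->
  ~ finitely_generated F ->
  forall s : seq {x | x \in B}, exists a, a \notin s.
Proof.
move=> freeB infF s; apply: contrapT => /forallNP s_full; apply: infF.
exists (map val s); apply/seteqP; split=> // x _ K [K_sub sK].
have [K1 KD] := K_sub.
have KV y : K y -> K y^-1 by move=> Ky; rewrite -[y^-1]mul1g; apply: KD.
have [p _ <-] := weval_surj (free_basis_unique freeB) x.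
elim: p => //= -[b e] p IHp; rewrite -[weval _ p]invgK; apply: KD; last exact: KV.
have Kb : K (val b).
  by apply: sK => /=; apply: map_f; apply: contrapT => /negP/s_full.
by rewrite /leval; case: e => //=; apply: KV.
Qed.

(** * The defining formula *)

Definition tcommg n (s t : gterm n) : gterm n :=
  TMul (TInv s) (TMul (TInv t) (TMul s t)).

Definition tconjg n (s t : gterm n) : gterm n := TMul (TInv t) (TMul s t).

Definition fcommute n (s t : gterm n) : gformula n := FEq (TMul s t) (TMul t s).

(** The quantifiers bind [a], [b], [c] from the outside in, so the innermost [c] has index 0 and the
    free variable [phi] is shifted to index 3. *)
Definition inner_like_formula : gformula 1 :=
  let c := TVar ord0 in
  let b := TVar (lift ord0 ord0) in
  let a := TVar (lift ord0 (lift ord0 ord0)) in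
  let phi := TVar (lift ord0 (lift ord0 (lift ord0 ord0))) in
  let z := tcommg a phi in
  FForall (FForall (FForall
    (FImp (FNot (FEq z TOne))
    (FImp (fcommute b z) (FImp (fcommute b (tconjg z phi))
    (FImp (fcommute c z) (FImp (fcommute c (tconjg z phi))
      (fcommute phi (tcommg b c))))))))).

Lemma env_cons0 (G : groupType) n (x : G) (e : 'I_n -> G) :
  env_cons x e ord0 = x.
Proof. by rewrite /env_cons unlift_none. Qed.

Lemma env_consS (G : groupType) n (x : G) (e : 'I_n -> G) i :
  env_cons x e (lift ord0 i) = e i.
Proof. by rewrite /env_cons liftK. Qed.

Lemma realizations_inner_like (G : groupType) :
  realizations inner_like_formula = [set phi : G | inner_like phi].
Proof.
apply/seteqP; split=> phi; rewrite /realizations /inner_like /=;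
  move=> phi_inn a b c; have := phi_inn a b c;
  by rewrite /= !(env_consS, env_cons0).
Qed.

Theorem theorem4p1 (F : groupType) (hfree : free_group F)
    (hinf : ~ finitely_generated F) :
  @definable_subgroup (Aut F) (@Inn F).
Proof.
split; first exact: subgroup_Inn.
have [B freeB] := hfree.
have extF := free_basis_extensions freeB.
have uniqF := free_basis_unique freeB.
have infB := infinite_basis freeB hinf.
exists inner_like_formula; rewrite realizations_inner_like.
apply/seteqP; split=> phi /=; last exact: (inner_like_Inn extF uniqF infB).
by move=> /InnP[g ->]; apply: (inner_like_inn extF uniqF infB).
Qed.
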